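(* Let $G=G([n],E)$ be a simple undirected graph with Laplacian matrix $L$, and let $I$ be the $n\times n$ identity matrix. Then $G$ is a comparability graph if and only if there exist $\alpha\in\mathbb{R}_{\ge0}$ and an acyclic orientation $O$ of $E$ such that $C_O$ is invariant under left-multiplication by $\alpha I+L$ (i.e. $(\alpha I+L)x\in C_O$ for all $x\in C_O$). Moreover, if $G$ is a comparability graph, the acyclic orientations $O$ satisfying this condition (for some $\alpha\ge0$) are precisely the transitive orientations of $G$, and for them one can take $\alpha=0$.
   Context: $L_{ii}=\deg i$, $L_{ij}=-1$ if $\{i,j\}\in E$, else $0$. An acyclic orientation $O$ orients every edge with no directed cycles; it is transitive if the comparability graph of its reachability partial order equals $G$. $C_O=\{x\in\mathbb{R}^{[n]}:x_i\le x_j\text{ for all }(i,j)\in O\}$, the closure of the region of the graphical arrangement $\{x:x_i=x_j\text{ for some }\{i,j\}\in E\}$ corresponding to $O$. *)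

(* Defs.v *)
From mathcomp Require Import all_boot all_order all_algebra.
From mathcomp Require Import classical_sets reals.

Set Implicit Arguments.
Unset Strict Implicit.
Unset Printing Implicit Defensive.

Import Order.TTheory GRing.Theory Num.Theory.
Local Open Scope ring_scope.

(* A simple undirected graph on [T] is a symmetric irreflexive [E : rel T]. *)

Definition comparability_of (T : finType) (le : rel T) : rel T :=
  fun x y => (x != y) && (le x y || le y x).

Definition is_comparability_graph (T : finType) (E : rel T) : Prop :=
  exists le : rel T,
    [/\ reflexive le, antisymmetric le, transitive le
      & comparability_of le =2 E].

(* [O x y] reads "the edge {x, y} is directed from x to y". *)
Definition is_orientation (T : finType) (E O : rel T) : Prop :=
  subrel O E /\ forall x y, E x y -> O x y (+) O y x.

Definition is_acyclic (T : finType) (O : rel T) : Prop :=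
  forall c : seq T, ucycle O c -> c = [::].

Definition acyclic_orientation (T : finType) (E O : rel T) : Prop :=
  is_orientation E O /\ is_acyclic O.

Definition transitive_orientation (T : finType) (E O : rel T) : Prop :=
  acyclic_orientation E O /\ comparability_of (connect O) =2 E.

Definition degree (T : finType) (E : rel T) (x : T) : nat := #|E x|.

Definition laplacian (R : realType) (n : nat) (E : rel 'I_n) : 'M[R]_n :=
  \matrix_(i, j) if i == j then (degree E i)%:R
                 else if E i j then -1 else 0.

Definition orientation_cone (R : realType) (n : nat) (O : rel 'I_n) :
    set 'cV[R]_n :=
  fun x => forall i j : 'I_n, O i j -> x i 0 <= x j 0.

Definition mul_invariant (R : realType) (n : nat) (M : 'M[R]_n)
    (C : set 'cV[R]_n) : Prop :=
  forall x, C x -> C (M *m x).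

(* Main.v *)
Require Import Defs.
From mathcomp Require Import all_boot all_order all_algebra.
From mathcomp Require Import classical_sets reals.

(** Since (L x)_i is the sum of x_i - x_k over the neighbours k of i, for a
    transitive orientation and an edge i -> j the difference (L x)_j - (L x)_i
    is a sum over vertices k of terms that are nonnegative on the cone.
    Conversely, suppose the cone of O is invariant.  By induction along O from
    the sinks, assume O is transitive out of j, and let i -> j -> k.  Test the
    invariance on the indicator of the set U of vertices reachable from k: on
    the edge i -> j it says that i has at least as many neighbours in U as j.
    But j is adjacent to all of U, hence so is i, and in particular i -> k. *)

Set Implicit Arguments.
Unset Strict Implicit.
Unset Printing Implicit Defensive.

Import Order.TTheory GRing.Theory Num.Theory.
Local Open Scope ring_scope.

(** A path from [y] back to [x], shortened to one without repeated vertices, closes up with the edge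
    [x -> y] to a nonempty simple cycle. *)
Lemma acyclic_connect (T : finType) (O : rel T) (x y : T) :
  is_acyclic O -> O x y -> ~~ connect O y x.
Proof.
move=> acyc Oxy; apply/negP => /connectP[p pth def_x].
case/shortenP: pth def_x => q pth_q uniq_q _ def_x.
suff: y :: q = [::] by [].
by apply: acyc; rewrite /ucycle /= rcons_path pth_q -def_x Oxy.
Qed.

Lemma connect_of_transitive (T : finType) (O : rel T) :
  transitive O -> connect O =2 fun x y => (x == y) || O x y.
Proof.
move=> Otr x y; apply/idP/idP; last first.
  by case/predU1P=> [->|/connect1].
case/connectP=> [] [_ -> | z p /(order_path_min Otr)/allP Ox ->].
  by rewrite /= eqxx.
by rewrite Ox ?orbT //= mem_last.
Qed.

Lemma acyclic_of_transitive (T : finType) (O : rel T) :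
  irreflexive O -> transitive O -> is_acyclic O.
Proof.
move=> Oirr Otr [//|x p] /andP[/(order_path_min Otr)/allP Ox _].
by have := Ox x; rewrite mem_rcons mem_head Oirr => /(_ isT).
Qed.

Lemma orientation_edge (T : finType) (E O : rel T) (x y : T) :
  symmetric E -> is_orientation E O -> E x y = O x y || O y x.
Proof.
move=> Esym [sub tour]; apply/idP/orP; last by case=> /sub //; rewrite Esym.
by move/tour; case: (O x y) => /= Oyx; [left | right].
Qed.

(** The ends of [x -> y -> z] are comparable under reachability, hence adjacent, and acyclicity
    directs that edge from [x] to [z]. Conversely, reachability along a transitive [O] is just its
    reflexive closure. *)
Lemma transitive_orientationP (T : finType) (E O : rel T) :
  symmetric E -> irreflexive E ->
  transitive_orientation E O <-> acyclic_orientation E O /\ transitive O.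
Proof.
move=> Esym Eirr; split=> [[[orO acyc] cmp] | [[orO acyc] Otr]].
  split=> // y x z Oxy Oyz.
  have /negP nzx : ~~ connect O z x.
    apply/negP => zx; have /negP := acyclic_connect acyc Oxy; apply.
    exact: connect_trans (connect1 Oyz) zx.
  have xz : connect O x z by apply: connect_trans (connect1 Oxy) (connect1 Oyz).
  have : E x z.
    rewrite -cmp /comparability_of xz andbT.
    by apply/eqP => eq_xz; apply: nzx; rewrite eq_xz.
  by rewrite (orientation_edge _ _ Esym orO) => /orP[// | /connect1].
split=> // x y; rewrite /comparability_of !connect_of_transitive //.
rewrite (orientation_edge _ _ Esym orO) eq_sym; case: eqVneq => //= <-.
by rewrite orbb; apply/esym/negP => /(proj1 orO); rewrite Eirr.
Qed.

(** Orient every edge upwards in the given order; antisymmetry rules out both directions at once. *)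
Lemma comparability_transitive_orientation (T : finType) (E : rel T) :
  symmetric E -> irreflexive E -> is_comparability_graph E ->
  exists O : rel T, transitive_orientation E O.
Proof.
move=> Esym Eirr [le [_ le_anti le_tr cmp]].
pose O x y := (x != y) && le x y.
have Oirr : irreflexive O by move=> x; rewrite /O eqxx.
have Otr : transitive O.
  move=> y x z /andP[nxy xy] /andP[_ yz]; rewrite /O (le_tr _ _ _ xy yz) andbT.
  apply: contraNneq nxy => eq_xz; apply/eqP/le_anti.
  by rewrite xy eq_xz yz.
exists O; apply/transitive_orientationP=> //; split=> //.
split; last exact: acyclic_of_transitive.
split=> x y; first by case/andP=> nxy xy; rewrite -cmp /comparability_of nxy xy.
rewrite -cmp /comparability_of /O eq_sym => /andP[nyx].
have := @le_anti x y; rewrite nyx /=.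
case: (le x y) (le y x) => [] [] //= /(_ isT) eq_xy.
by rewrite eq_xy eqxx in nyx.
Qed.

Lemma transitive_orientation_comparability (T : finType) (E O : rel T) :
  transitive_orientation E O -> is_comparability_graph E.
Proof.
move=> [[_ acyc] cmp]; exists (connect O); split=> //.
- move=> x y /andP[/connectP[[_ -> // | z p /= /andP[Oxz pth] def_y]] yx].
  have /negP[] := acyclic_connect acyc Oxz.
  by apply: connect_trans yx; apply/connectP; exists p.
- exact: connect_trans.
Qed.

Section LaplacianCone.

Variables (R : realType) (n : nat) (E O : rel 'I_n).
Hypotheses (Esym : symmetric E) (Eirr : irreflexive E).

Lemma mul_scalar_laplacianE (alpha : R) (x : 'cV[R]_n) (i : 'I_n) :
  ((alpha%:M + laplacian R E) *m x) i 0 =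
    alpha * x i 0 + \sum_(k | E i k) (x i 0 - x k 0).
Proof.
rewrite mulmxDl mul_scalar_mx !mxE sumrB; congr (_ + _).
(* The diagonal entry contributes one copy of [x i 0] per neighbour of [i]. *)
rewrite (bigD1 i) //= mxE eqxx sumr_const mulr_natl; congr (_ + _).
rewrite -sumrN big_mkcond [RHS]big_mkcond /=; apply: eq_bigr => k _.
rewrite mxE eq_sym; case: eqVneq => [->|_] /=; first by rewrite Eirr.
by case: (E i k); rewrite ?mulN1r ?mul0r.
Qed.

Lemma laplacian_cone_invariant :
  transitive_orientation E O ->
  mul_invariant (0%:M + laplacian R E) (orientation_cone O).
Proof.
move=> /(transitive_orientationP O Esym Eirr)[[orO _] Otr] x xC i j Oij.
have Eor a b := orientation_edge a b Esym orO.
rewrite !mul_scalar_laplacianE !mul0r !add0r !(big_mkcond (E _)) /=.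
apply: ler_sum => k _.
have xij := xC _ _ Oij.
(* If [k] is adjacent to [i] only, then [i -> k], since [k -> i -> j] would make [k] adjacent to
   [j]. Dually, if [k] is adjacent to [j] only, then [k -> j]. *)
case Eik: (E i k); case Ejk: (E j k) => //.
- by rewrite lerD2r.
- rewrite subr_le0; move: Eik; rewrite Eor => /orP[/xC // | Oki].
  by move: Ejk; rewrite Eor (Otr _ _ _ Oki Oij) orbT.
- rewrite subr_ge0; move: Ejk; rewrite Eor => /orP[Ojk | /xC //].
  by move: Eik; rewrite Eor (Otr _ _ _ Oij Ojk).
Qed.

(** The indicator of the up-closed set [U] lies in the cone. It vanishes at [i] and [j], so the
    [alpha] term drops out there and the Laplacian returns minus the number of neighbours in [U]. *)
Lemma cone_invariant_card (alpha : R) (U : {set 'I_n}) (i j : 'I_n) :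
  mul_invariant (alpha%:M + laplacian R E) (orientation_cone O) ->
  (forall a b, O a b -> a \in U -> b \in U) -> O i j ->
  i \notin U -> j \notin U ->
  (#|[set k in U | E j k]| <= #|[set k in U | E i k]|)%N.
Proof.
move=> inv upU Oij iU jU; pose x : 'cV[R]_n := \col_k (k \in U)%:R.
have valx a : a \notin U ->
    ((alpha%:M + laplacian R E) *m x) a 0 = - #|[set k in U | E a k]|%:R.
  move=> aU; rewrite mul_scalar_laplacianE mxE (negPf aU) mulr0 add0r.
  rewrite -sum1_card natr_sum -sumrN big_mkcond [RHS]big_mkcond /=.
  apply: eq_bigr => k _; rewrite inE mxE.
  by case: (E a k); case: (k \in U); rewrite ?subr0 ?sub0r.
have xC : orientation_cone O x.
  move=> a b Oab; rewrite !mxE ler_nat.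
  by case: (boolP (a \in U)) => [/(upU _ _ Oab) ->|].
by have := inv x xC i j Oij; rewrite !valx // lerN2 ler_nat.
Qed.

Lemma cone_invariant_transitive (alpha : R) :
  acyclic_orientation E O ->
  mul_invariant (alpha%:M + laplacian R E) (orientation_cone O) ->
  transitive O.
Proof.
move=> [orO acyc] inv.
suff trO m i j k : (#|connect O i| < m)%N -> O i j -> O j k -> O i k.
  (* Induction on the number of vertices reachable from [i]: it drops along [i -> j], because [j]
     cannot reach [i]. *)
  by move=> j i k; apply: trO (ltnSn _).
elim: m => // m IHm in i j k * => ltm Oij Ojk.
have nji := acyclic_connect acyc Oij; have nkj := acyclic_connect acyc Ojk.
have nki : ~~ connect O k i.
  by apply: contra nji; apply: connect_trans (connect1 Ojk).
have ltj : (#|connect O j| < m)%N.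
  rewrite ltnS in ltm; apply: leq_trans ltm; apply/proper_card/properP; split.
    by apply/fintype.subsetP => a; apply: connect_trans (connect1 Oij).
  by exists i => //; apply: connect0.
(* Follow a path from [k], extending the edge out of [j] one step at a time by the induction
   hypothesis. *)
have Oj_all w : connect O k w -> O j w.
  case/connectP=> p pth ->; elim: p k Ojk pth {nkj nki} => //= a p IHp k Ojk.
  by case/andP=> Oka; apply: IHp (IHm _ _ _ ltj Ojk Oka).
pose U := [set w | connect O k w].
have upU a b : O a b -> a \in U -> b \in U.
  by rewrite !inE => Oab ka; apply: connect_trans ka (connect1 Oab).
have := cone_invariant_card inv upU Oij; rewrite !inE => /(_ nki nkj).
have -> : [set w in U | E j w] = U.
  apply/setP => w; rewrite inE andb_idr // inE => /Oj_all.
  exact: (proj1 orO).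
move=> leU; have /eqP eqU : [set w in U | E i w] == U.
  by rewrite eqEcard leU andbT; apply/fintype.subsetP => w; rewrite inE => /andP[].
have : k \in U by rewrite inE connect0.
rewrite -eqU inE (orientation_edge _ _ Esym orO) => /andP[_].
(* The edge between [i] and [k] cannot point to [i], as [k] does not reach [i]. *)
by case/orP=> // /connect1; rewrite (negPf nki).
Qed.

End LaplacianCone.

Theorem theorem4p1 (R : realType) (n : nat) (E : rel 'I_n)
    (Esym : symmetric E) (Eirr : irreflexive E) :
  (is_comparability_graph E <->
     exists alpha : R, 0 <= alpha /\
       exists O : rel 'I_n, acyclic_orientation E O /\
         mul_invariant (alpha%:M + laplacian R E) (orientation_cone O))
  /\
  (is_comparability_graph E ->
     (forall O : rel 'I_n,
        (acyclic_orientation E O /\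
         exists alpha : R, 0 <= alpha /\
           mul_invariant (alpha%:M + laplacian R E) (orientation_cone O))
        <-> transitive_orientation E O)
     /\
     (forall O : rel 'I_n, transitive_orientation E O ->
        mul_invariant (0%:M + laplacian R E) (orientation_cone O))).
Proof.
have inv_to O alpha : acyclic_orientation E O ->
    mul_invariant (alpha%:M + laplacian R E) (orientation_cone O) ->
    transitive_orientation E O.
  move=> aO inv; apply/transitive_orientationP=> //; split=> //.
  exact: cone_invariant_transitive aO inv.
have to_inv O := @laplacian_cone_invariant R n E O Esym Eirr.
split.
  split=> [/(comparability_transitive_orientation Esym Eirr)[O tO] |].
    exists 0; split=> //; exists O; split; [exact: (proj1 tO) | exact: to_inv].
  move=> [alpha [_ [O [aO inv]]]].
  exact: transitive_orientation_comparability (inv_to _ _ aO inv).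
move=> _; split=> // O; split=> [[aO [alpha [_ inv]]] | tO].
  exact: inv_to aO inv.
split; first exact: (proj1 tO).
by exists 0; split=> //; apply: to_inv.
Qed.
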